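(* Let $F$ be a multigraph, let $k\geq 1$ be an integer and let $K\geq 1$. Suppose that $G$ is a $K$-almost-regular graph on $n$ vertices with minimum degree $\delta=\omega(n^{\frac{1}{2k}})$ (that is, $\delta=\delta(n)$ satisfies $\delta(n)/n^{\frac{1}{2k}}\to\infty$ as $n\to\infty$). Then, for $n$ sufficiently large, $G$ contains a copy of $F^{2k-1}$.
   Context: A graph $G$ is $K$-almost-regular if $\max_{v\in V(G)} d(v)\leq K\min_{v\in V(G)} d(v)$, where $d(v)$ is the degree of $v$. For a multigraph $F$, $F^{2k-1}$ denotes the graph obtained by replacing the edges of $F$ with pairwise internally vertex-disjoint paths of length $2k$. Asymptotic notation refers to $n\to\infty$ with $F,k,K$ fixed. *)

(* Defs.v *)
From mathcomp Require Import all_boot all_order all_algebra.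
From mathcomp Require Import reals.

Set Implicit Arguments.
Unset Strict Implicit.
Unset Printing Implicit Defensive.

Local Open Scope ring_scope.

Record sgraph := SGraph {
  vertex :> finType;
  adj : rel vertex;
  adj_sym : symmetric adj;
  adj_irr : irreflexive adj }.

Definition degree (G : sgraph) (v : G) : nat := #|[set w : G | adj v w]|.

(* Degrees never exceed #|G|, so the default value #|G| of the iterated minimum
   only matters for the graph without vertices. *)
Definition min_degree (G : sgraph) : nat := \big[minn/#|G|]_(v : G) degree v.

Definition max_degree (G : sgraph) : nat := \max_(v : G) degree v.

Definition almost_regular (R : realType) (K : R) (G : sgraph) : Prop :=
  (max_degree G)%:R <= K * (min_degree G)%:R.

(* Not necessarily induced. *)
Definition contains_copy (G H : sgraph) : Prop :=
  exists2 f : H -> G, injective f & forall x y : H, adj x y -> adj (f x) (f y).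

(* Finite loopless multigraphs.  Edges are unoriented: which end of an edge is
   called [src] and which [tgt] is an arbitrary choice used to traverse the path
   that replaces it. *)
Record multigraph := Multigraph {
  mvertex : finType;
  medge : finType;
  src : medge -> mvertex;
  tgt : medge -> mvertex;
  no_loop : forall e, src e != tgt e }.

Section Subdivision.
Variables (F : multigraph) (m : nat).

Definition subdiv_vertex : finType := (mvertex F + medge F * 'I_m)%type.

(* The path of length m.+1 replacing e: position 0 is [src e], positions 1 .. m
   are the m new vertices of e, and position m.+1 is [tgt e]. *)
Definition subdiv_path (e : medge F) (i : nat) : subdiv_vertex :=
  if i is j.+1 then
    if insub j is Some o then inr (e, o) else inl (tgt e)
  else inl (src e).

Definition subdiv_adj : rel subdiv_vertex := fun x y =>
  [exists e : medge F, [exists i : 'I_m.+1,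
     ((x == subdiv_path e i) && (y == subdiv_path e i.+1)) ||
     ((y == subdiv_path e i) && (x == subdiv_path e i.+1))]].

Lemma subdiv_adj_sym : symmetric subdiv_adj.
Proof.
by move=> x y; apply: eq_existsb => e; apply: eq_existsb => i; rewrite orbC.
Qed.

Lemma subdiv_path_neq (e : medge F) (i : nat) :
  (i <= m)%N -> subdiv_path e i != subdiv_path e i.+1.
Proof.
case: i => [_|i im] /=.
  case: insubP => [//|_]; apply/eqP => -[/eqP].
  by apply/negP; exact: no_loop.
rewrite insubT; case: insubP => [o _ oi|//]; apply/eqP => -[oE].
by move: oi; rewrite -oE /= => /eqP; rewrite ltn_eqF.
Qed.

Lemma subdiv_adj_irr : irreflexive subdiv_adj.
Proof.
move=> x; apply/negbTE/existsPn => e; apply/existsPn => i.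
have := @subdiv_path_neq e i (ltn_ord i).
by rewrite orbb; apply: contra => /andP[/eqP<- /eqP<-].
Qed.

(* Every edge of F is replaced by a path with m inner vertices, i.e. of length
   m.+1; for F^{2k-1} take m = 2k-1. *)
Definition subdivision : sgraph := SGraph subdiv_adj_sym subdiv_adj_irr.

End Subdivision.

(* Main.v *)
Require Import Defs.
From mathcomp Require Import all_boot all_order all_algebra.
From mathcomp Require Import all_classical all_reals all_analysis.
From mathcomp Require Import zify.
Import Order.TTheory GRing.Theory Num.Theory.
Import numFieldNormedType.Exports.

(** Count pairs of walks of length q = 2k with common ends, i.e. closed walks of
    length 4k.  If such a pair is degenerate (some vertex is repeated), it can
    be re-rooted as two closed walks of lengths i and 4k - i at one vertex, with
    0 < i < 4k.  By log-convexity of i |-> c_i(v), the number of closed walks of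
    even length i at v, the number of degenerate pairs is O(Delta h_(4k-2)),
    where h_i is the total number of closed walks.  The sequence h_(2j) is
    log-convex too, h_0 = n and h_(4k) >= delta^(4k), so
    h_(4k) / h_(4k-2) >= delta^2 / n^(1/2k), and only o(h_(4k)) pairs are
    degenerate.

    Call (x, y) light if a positive proportion of the pairs of 2k-walks from x to
    y is degenerate; otherwise Turan's argument yields many internally disjoint
    paths of length 2k from x to y.  A closed 4k-walk through x, z, y, z' at
    distance k shows that, for fixed (z, z'), the pair (x, y) is weighted by the
    product w(x) w(y), where w(x) counts walks of length 2k from z to z' with
    midpoint x.  Since light pairs have little total weight, some (z, z') has
    few light pairs, and Turan's argument again gives any number of pairwise
    non-light vertices, which serve as branch vertices. *)

Set Implicit Arguments.
Unset Strict Implicit.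
Unset Printing Implicit Defensive.

(** * Averaging, Cauchy-Schwarz and a weighted Turan argument *)

Lemma ltn_sum_ex (I : eqType) (s : seq I) (F G : I -> nat) :
  \sum_(i <- s) F i < \sum_(i <- s) G i -> exists2 i, i \in s & F i < G i.
Proof.
move=> ltFG; apply/hasP; apply: contraTT ltFG => /hasPn leGF.
by rewrite -leqNgt !big_seq; apply: leq_sum => i /leGF; rewrite -leqNgt.
Qed.

Lemma cauchy_schwarz_nat (I : finType) (f g : I -> nat) :
  (\sum_i f i * g i) ^ 2 <= (\sum_i f i ^ 2) * (\sum_i g i ^ 2).
Proof.
have sumM (F G : I -> nat) :
  (\sum_i F i) * (\sum_i G i) = \sum_i \sum_j F i * G j.
  by rewrite big_distrl; apply: eq_bigr => i _; rewrite big_distrr.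
set fg2 := _ * _; have fgE : fg2 = \sum_i \sum_j f i ^ 2 * g j ^ 2 by exact: sumM.
have gfE : fg2 = \sum_i \sum_j f j ^ 2 * g i ^ 2 by rewrite fgE exchange_big.
rewrite -(leq_pmul2l (isT : 0 < 2)) -mulnn sumM mul2n mul2n -!addnn.
rewrite {1}fgE gfE -!big_split /=; apply: leq_sum => i _.
rewrite -!big_split /=; apply: leq_sum => j _.
by have [+ _] := nat_Cauchy (f i * g j) (f j * g i); rewrite -!mulnn; lia.
Qed.

(** Greedy selection: by averaging, some x has less than a quarter of the total weight [B]-related
    to it. Deleting that weight keeps over 3/4 of the total, so one factor 4 pays for the step. The
    last clause gives each chosen x a partner, from which walks are later seen to be simple. *)
Lemma pairwise_avoiding (T : eqType) (l : seq T) (w : T -> nat) (B : rel T) (r : nat) :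
  4 ^ r * (\sum_(x <- l) \sum_(y <- l) w x * w y * B x y) <
    (\sum_(x <- l) w x) ^ 2 ->
  exists s : seq T, [/\ size s = r, pairwise (fun x y => ~~ B x y) s &
    {in s, forall x, [/\ x \in l, 0 < w x & exists2 y, y \in l & 0 < w y /\ ~~ B x y]}].
Proof.
elim: r w => [|r IHr] w; first by exists [::]; split.
set W := \sum_(x <- l) w x; set b := \sum_(x <- l) _ => bW.
pose d x := \sum_(y <- l) w y * B x y.
have bE : b = \sum_(x <- l) w x * d x.
  apply: eq_bigr => x _; rewrite big_distrr /=.
  by apply: eq_bigr => y _; rewrite mulnA.
have [x xl dx] : exists2 x, x \in l & 4 * (w x * d x) < w x * W.
  apply: ltn_sum_ex; rewrite -big_distrr -big_distrl /= -bE -/W mulnn.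
  by apply: leq_ltn_trans bW; rewrite leq_mul2r orbC -{1}(expn1 4) leq_exp2l.
have wx : 0 < w x by lia.
have {}dx : 4 * d x < W by nia.
pose w' y := w y * ~~ B x y.
have w'w y : w' y <= w y by rewrite /w'; lia.
have WE : \sum_(y <- l) w' y + d x = W.
  by rewrite -big_split /=; apply: eq_bigr => y _; rewrite /w'; lia.
have [|s [sz ps ms]] := IHr w'.
  set b' := \sum_(y <- l) _; have b'b : b' <= b.
    by apply: leq_sum => y _; apply: leq_sum => z _; rewrite leq_mul // leq_mul.
  have := leq_mul (leqnn (4 ^ r)) b'b; move: bW; rewrite expnS; nia.
exists (x :: s); split => [|/=|y]; first by rewrite /= sz.
  rewrite ps andbT; apply/allP => y /ms[_]; rewrite /w'; lia.
rewrite inE => /orP[/eqP->|/ms[yl wy [z zl [wz yz]]]]; last first.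
  by split => //; [rewrite (leq_trans wy) | exists z => //; rewrite (leq_trans wz)].
split => //; have [z zl wz] : exists2 z, z \in l & 0 < w' z.
  by apply: (@ltn_sum_ex _ l (fun=> 0)); rewrite big1 //; lia.
by exists z => //; move: wz; rewrite /w'; lia.
Qed.

(** * Log-convex sequences *)

Section LogConvex.
Variable a : nat -> nat.
Hypothesis a_gt0 : forall i, 0 < a i.
Hypothesis a_cvx : forall i, a i.+1 ^ 2 <= a i * a i.+2.

(** Monotonicity of the ratios [a i.+1 / a i], cross-multiplied. *)
Lemma logconvex_slope i j : i <= j -> a i.+1 * a j <= a i * a j.+1.
Proof.
move=> /subnKC<-; elim: (j - i) => [|e IHe]; first by rewrite addn0 (mulnC (a i)).
rewrite addnS -(leq_pmul2l (a_gt0 (i + e))).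
have := a_cvx (i + e); have := a_gt0 (i + e).+1; nia.
Qed.

(** Lowering the smaller index by one and raising the other never decreases the product. *)
Lemma logconvex_ends i m : 0 < i < m -> a i * a (m - i) <= a 1 * a m.-1.
Proof.
have half i' : 0 < i' -> i'.*2 <= m -> a i' * a (m - i') <= a 1 * a m.-1.
  elim: i' => // -[|i'] IHi _ im; first by rewrite subn1.
  apply: leq_trans (IHi _ _) => //; last lia.
  have -> : m - i'.+1 = (m - i'.+2).+1 by lia.
  by apply: logconvex_slope; lia.
case/andP=> i0 im; case: (leqP i.*2 m) => [|h]; first exact: half.
by have := half (m - i); rewrite (subKn (ltnW im)) (mulnC (a (m - i))); apply; lia.
Qed.

(** The last ratio is the largest, so c bounds them all and they telescope. *)
Lemma logconvex_geom m c : a m.+1 <= c * a m -> a m.+1 <= c ^ m.+1 * a 0.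
Proof.
move=> am; have slope i : i <= m -> a i.+1 <= c * a i.
  move=> /logconvex_slope; have := a_gt0 m; nia.
have geom i : i <= m.+1 -> a i <= c ^ i * a 0.
  elim: i => [|i IHi] im; first by rewrite mul1n.
  by rewrite expnS -mulnA (leq_trans (slope i im)) // leq_mul2l IHi ?orbT // ltnW.
exact: geom.
Qed.
End LogConvex.

(** * Counting walks and closed walks *)

Section Walks.
Variable G : sgraph.
Implicit Types (x y v : G) (t : seq G).

(** Walks omit their start, as for [path]: the size is the length, and position i is entry i of
    [x :: t]. *)
Fixpoint walks (q : nat) (x : G) : seq (seq G) :=
  if q is q'.+1 then
    [seq y :: t | y <- enum (adj x), t <- walks q' y]
  else [:: [::]].

Definition nwalks (q : nat) (x y : G) : nat :=
  \sum_(t <- walks q x) (last x t == y).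

Lemma mem_walks q x t : (t \in walks q x) = (size t == q) && path (@adj G) x t.
Proof.
elim: q x t => [|q IHq] x [|y t] //=.
  by apply/negP => /allpairsPdep[y [t [_ _]]].
apply/allpairsPdep/idP => [[z [s [+ + [-> ->]]]]|/and3P[sq xy yt]].
  by rewrite mem_enum IHq => xz /andP[sq zs]; rewrite eqSS sq zs andbT.
by exists y, t; rewrite mem_enum IHq yt andbT.
Qed.

Lemma sum_walksD a b x (f : seq G -> nat) :
  \sum_(t <- walks (a + b) x) f t =
  \sum_(s <- walks a x) \sum_(t <- walks b (last x s)) f (s ++ t).
Proof.
elim: a x f => [|a IHa] x f /=; first by rewrite big_seq1.
rewrite !big_allpairs_dep; apply: eq_bigr => y _.
by rewrite (IHa y (fun t => f (y :: t))).
Qed.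

Lemma sum_walks_last q x (f : G -> nat) :
  \sum_(t <- walks q x) f (last x t) = \sum_v nwalks q x v * f v.
Proof.
under [RHS]eq_bigr do rewrite big_distrl.
rewrite exchange_big; apply: eq_bigr => t _ /=.
rewrite (bigD1 (last x t)) //= eqxx mul1n big1 ?addn0 // => v.
by rewrite eq_sym => /negbTE->.
Qed.

Lemma nwalksD a b x y :
  nwalks (a + b) x y = \sum_v nwalks a x v * nwalks b v y.
Proof.
rewrite -(sum_walks_last a x (fun v => nwalks b v y)) /nwalks sum_walksD.
by apply: eq_bigr => s _; apply: eq_bigr => t _; rewrite last_cat.
Qed.

Lemma nwalks0 x y : nwalks 0 x y = (x == y).
Proof. by rewrite /nwalks big_seq1. Qed.

Lemma nwalksS q x y : nwalks q.+1 x y = \sum_(z | adj x z) nwalks q z y.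
Proof. by rewrite /nwalks big_allpairs_dep big_enum. Qed.

Lemma nwalks1 x y : nwalks 1 x y = adj x y.
Proof.
rewrite nwalksS big_mkcond (bigD1 y) //= nwalks0 eqxx big1 ?addn0 => [|z zy].
  by case: adj.
by rewrite nwalks0 (negbTE zy) if_same.
Qed.

Lemma nwalksC q x y : nwalks q x y = nwalks q y x.
Proof.
elim: q x y => [|q IHq] x y; first by rewrite !nwalks0 eq_sym.
rewrite -addn1 nwalksD addnC nwalksD; apply: eq_bigr => z _.
by rewrite IHq !nwalks1 adj_sym mulnC.
Qed.

Lemma nwalks_diag1 x : nwalks 1 x x = 0.
Proof. by rewrite nwalks1 adj_irr. Qed.

Lemma nwalks_diag2 x : nwalks 2 x x = degree x.
Proof.
rewrite nwalksS /degree cardsE -sum1_card; apply: eq_bigr => z xz.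
by rewrite nwalks1 adj_sym xz.
Qed.

Lemma nwalks_diagD a b x : nwalks (a + b) x x = \sum_v nwalks a x v * nwalks b x v.
Proof. by rewrite nwalksD; apply: eq_bigr => v _; rewrite (nwalksC b). Qed.

(** Cauchy-Schwarz for row x of two powers of the adjacency matrix; b = a + 2 gives log-convexity
    along even lengths. *)
Lemma nwalks_diag_cs a b x :
  nwalks (a + b) x x ^ 2 <= nwalks a.*2 x x * nwalks b.*2 x x.
Proof.
by rewrite -!addnn !nwalks_diagD; exact: cauchy_schwarz_nat.
Qed.

Definition closed_walks (q : nat) : nat := \sum_x nwalks q x x.

Lemma closed_walksD a b : closed_walks (a + b) =
  \sum_x \sum_y nwalks a x y * nwalks b x y.
Proof. by apply: eq_bigr => x _; exact: nwalks_diagD. Qed.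

Lemma closed_walks_cs a b :
  closed_walks (a + b) ^ 2 <= closed_walks a.*2 * closed_walks b.*2.
Proof.
by rewrite -!addnn !closed_walksD !pair_bigA; exact: cauchy_schwarz_nat.
Qed.

Lemma closed_walks0 : closed_walks 0 = #|G|.
Proof.
by rewrite -sum1_card; apply: eq_bigr => x _; rewrite nwalks0 eqxx.
Qed.

(** * Closed walks in a graph of given minimum degree *)

Section MinDegree.
Variable d : nat.
Hypothesis le_d : forall x, d <= degree x.

Lemma sum_nwalks_ge q x : d ^ q <= \sum_y nwalks q x y.
Proof.
elim: q x => [|q IHq] x.
  by rewrite (bigD1 x) //= nwalks0 eqxx.
under eq_bigr do rewrite nwalksS.
rewrite exchange_big expnS (@leq_trans (\sum_(y | adj x y) d ^ q)) ?leq_sum //.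
by rewrite sum_nat_const leq_mul2r -cardsE le_d orbT.
Qed.

(** With n = [#|G|], there are at least n d^q walks of length q, spread over n^2 pairs of ends;
    closed walks of length 2q are the sum of the squared counts. *)
Lemma closed_walks_ge q : 0 < #|G| -> d ^ q.*2 <= closed_walks q.*2.
Proof.
move=> G_gt0; have n2 : 0 < #|G| ^ 2 by rewrite expn_gt0 G_gt0.
rewrite -(leq_pmul2r n2) -muln2 expnM -expnMn.
have sum_ge : d ^ q * #|G| <= \sum_(p : G * G) nwalks q p.1 p.2 * 1.
  rewrite -(pair_bigA _ (fun x y => nwalks q x y * 1)) /= mulnC -sum_nat_const.
  by apply: leq_sum => x _; under eq_bigr do rewrite muln1; exact: sum_nwalks_ge.
rewrite -(leq_exp2r _ _ (isT : 0 < 2)) in sum_ge.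
apply: leq_trans sum_ge (leq_trans (cauchy_schwarz_nat _ _) _).
rewrite muln2 -addnn closed_walksD pair_bigA leq_mul //.
by rewrite sum_nat_const card_prod muln1.
Qed.

Hypothesis d_gt0 : 0 < d.

Lemma nwalks_diag_gt0 q x : 0 < nwalks q.*2 x x.
Proof.
rewrite -addnn nwalks_diagD lt0n sum_nat_eq0; apply/negP => /forallP nw0.
have := sum_nwalks_ge q x; rewrite big1 => [|v _].
  by rewrite leqNgt expn_gt0 d_gt0.
by have := nw0 v; rewrite implyTb mulnn expn_eq0 => /andP[/eqP].
Qed.

Lemma nwalks_diag_ends i q x : 1 < i -> i < q.*2.-1 ->
  nwalks i x x * nwalks (q.*2 - i) x x <= degree x * nwalks q.*2.-2 x x.
Proof.
pose a j := nwalks j.*2 x x.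
have ends j : 0 < j < q -> a j * a (q - j) <= degree x * nwalks q.*2.-2 x x.
  move=> jq; have -> : q.*2.-2 = q.-1.*2 by lia.
  rewrite -nwalks_diag2; apply: (@logconvex_ends a) => // [h|h].
    exact: nwalks_diag_gt0.
  rewrite /a; have -> : h.+1.*2 = h + h.+2 by lia.
  exact: nwalks_diag_cs.
move=> i1 iq; case: (boolP (odd i)) => oi; last first.
  have := ends i./2; rewrite /a doubleB; have -> : (i./2).*2 = i by lia.
  by apply; lia.
(* For odd i, Cauchy-Schwarz bounds each squared factor by its two even neighbours, and the four
   terms regroup into two even products. The bounds on i keep i - 1 and i + 1 away from 0 and 2q. *)
have e1 := ends i./2; have e2 := ends i./2.+1.
rewrite -(@leq_exp2r _ _ 2) // expnMn.
have cs1 := nwalks_diag_cs i./2 i./2.+1 x.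
have cs2 := nwalks_diag_cs (q - i./2) (q - i./2.+1) x.
have := leq_mul cs1 cs2.
have -> : i./2 + i./2.+1 = i by lia.
have -> : q - i./2 + (q - i./2.+1) = q.*2 - i by lia.
move=> /leq_trans; apply; rewrite -/(a _) -/(a _) -/(a _) -/(a _).
rewrite mulnACA -mulnn; apply: leq_mul; [apply: e1|apply: e2]; lia.
Qed.

Lemma sum_nwalks_diag_ends i q : 0 < i < q.*2 ->
  \sum_v nwalks i v v * nwalks (q.*2 - i) v v <= max_degree G * closed_walks q.*2.-2.
Proof.
move=> iq; rewrite big_distrr; apply: leq_sum => v _ /=.
have deg_v : degree v * nwalks q.*2.-2 v v <= max_degree G * nwalks q.*2.-2 v v.
  by rewrite leq_mul2r (leq_bigmax v) orbT.
(* The two extreme lengths contribute nothing: no closed walk has length 1. *)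
have [->|i1] := eqVneq i 1; first by rewrite nwalks_diag1.
have [->|i2] := eqVneq i q.*2.-1.
  have -> : q.*2 - q.*2.-1 = 1 by lia.
  by rewrite nwalks_diag1 muln0.
by apply: leq_trans deg_v; apply: nwalks_diag_ends; lia.
Qed.

(** Used contrapositively: a large d forces the last ratio of closed walk counts above c. *)
Lemma closed_walks_drop q c : 0 < #|G| -> 0 < q ->
  closed_walks q.*2 <= c * closed_walks q.*2.-2 -> d ^ q.*2 <= c ^ q * #|G|.
Proof.
move=> G0; case: q => // q _ drop.
apply: leq_trans (closed_walks_ge q.+1 G0) _; rewrite -closed_walks0.
apply: (@logconvex_geom (fun j => closed_walks j.*2)) => // [j|j].
  by apply: leq_trans (closed_walks_ge _ G0); rewrite expn_gt0 d_gt0.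
have -> : j.+1.*2 = j + j.+2 by lia.
exact: closed_walks_cs.
Qed.

End MinDegree.

End Walks.

(** As the start of a walk is not stored, only its end has to be dropped. *)
Definition interior (T : Type) (t : seq T) := take (size t).-1 t.

(** * Pairs of walks with common ends, and their coincidences *)

Section DegeneratePairs.
Variable G : sgraph.
Implicit Types (x y v : G) (t P Q : seq G).

Definition walks_to q x y : seq (seq G) := [seq t <- walks q x | last x t == y].

Lemma mem_walks_to q x y t :
  (t \in walks_to q x y) = [&& size t == q, path (@adj G) x t & last x t == y].
Proof. by rewrite mem_filter mem_walks andbC andbA. Qed.

Lemma sum_walks_to q x y (f : seq G -> nat) :
  \sum_(t <- walks_to q x y) f t = \sum_(t <- walks q x) f t * (last x t == y).
Proof.
by rewrite big_filter big_mkcond; apply: eq_bigr => t _; rewrite mulnC mulnbl.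
Qed.

Lemma sum1_walks_to q x y : \sum_(t <- walks_to q x y) 1 = nwalks q x y.
Proof. by rewrite sum_walks_to; apply: eq_bigr => t _; rewrite mul1n. Qed.

Lemma nth_walk_cat x (s t : seq G) d : d <= size t ->
  nth x (x :: s ++ t) (size s + d) = nth (last x s) (last x s :: t) d.
Proof.
rewrite -cat_cons nth_cat /=; case: d => [|d] dt.
  by rewrite addn0 ltnS leqnn -last_nth.
rewrite ifF; last by lia.
by rewrite /= addnS subSS addKn; exact: set_nth_default.
Qed.

Lemma sum_walks_through a b x v y :
  \sum_(t <- walks_to (a + b) x y) (nth x (x :: t) a == v) =
  nwalks a x v * nwalks b v y.
Proof.
rewrite sum_walks_to sum_walksD.
transitivity (\sum_(s <- walks a x) (last x s == v) * nwalks b (last x s) y).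
  rewrite !big_seq; apply: eq_bigr => s; rewrite mem_walks => /andP[/eqP sz _].
  rewrite /nwalks big_distrr /=; apply: eq_bigr => t _.
  by rewrite last_cat -(addn0 a) -sz nth_walk_cat.
rewrite (sum_walks_last a x (fun u => (u == v) * nwalks b u y)) (bigD1 v) //= eqxx mul1n.
by rewrite big1 ?addn0 // => u /negbTE->; rewrite mul0n muln0.
Qed.

Lemma sum_walks_return a d b x y :
  \sum_(t <- walks_to (a + (d + b)) x y) (nth x (x :: t) a == nth x (x :: t) (a + d)) =
  \sum_v nwalks a x v * (nwalks d v v * nwalks b v y).
Proof.
rewrite sum_walks_to sum_walksD.
rewrite -(sum_walks_last a x (fun v => nwalks d v v * nwalks b v y)).
rewrite !big_seq; apply: eq_bigr => s; rewrite mem_walks => /andP[/eqP sz _].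
rewrite -sum_walks_through sum_walks_to !big_seq.
apply: eq_bigr => t; rewrite mem_walks => /andP[/eqP tz _].
rewrite last_cat -{1}(addn0 a) -sz !nth_walk_cat //= 1?eq_sym //; lia.
Qed.

(** Re-rooting at the repeated vertex: the part of P between positions i and j is one closed walk,
    and the rest of P closed up by Q is the other. *)
Lemma sum_walks_return_pairs q i j : i < j <= q ->
  \sum_(p : G * G) \sum_(P <- walks_to q p.1 p.2) \sum_(Q <- walks_to q p.1 p.2)
    (nth p.1 (p.1 :: P) i == nth p.1 (p.1 :: P) j) =
  \sum_(v : G) nwalks (j - i) v v * nwalks (q.*2 - (j - i)) v v.
Proof.
move=> /andP[ij jq].
have qE : q = i + ((j - i) + (q - j)) by lia.
transitivity (\sum_(p : G * G) \sum_v
   nwalks i p.1 v * (nwalks (j - i) v v * nwalks (q - j) v p.2) * nwalks q p.1 p.2).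
  apply: eq_bigr => p _; rewrite -big_distrl -sum_walks_return -qE (subnKC (ltnW ij)).
  rewrite big_distrl; apply: eq_bigr => P _; rewrite -sum1_walks_to big_distrr.
  by apply: eq_bigr => Q _; rewrite /= muln1.
rewrite exchange_big; apply: eq_bigr => v _ /=.
have -> : q.*2 - (j - i) = (i + q) + (q - j) by lia.
rewrite nwalksD big_distrr -(pair_bigA _ (fun x y =>
   nwalks i x v * (nwalks (j - i) v v * nwalks (q - j) v y) * nwalks q x y)) exchange_big.
apply: eq_bigr => y _ /=; rewrite nwalksD mulnA mulnAC [RHS]big_distrr.
by apply: eq_bigr => x _ /=; rewrite (nwalksC i) (nwalksC (q - j) y); lia.
Qed.

(** Re-rooting at the meeting vertex: the initial segments of P and Q form one closed walk, the
    final segments the other. *)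
Lemma sum_walks_cross_pairs q i j : i <= q -> j <= q ->
  \sum_(p : G * G) \sum_(P <- walks_to q p.1 p.2) \sum_(Q <- walks_to q p.1 p.2)
    (nth p.1 (p.1 :: P) i == nth p.1 (p.1 :: Q) j) =
  \sum_(v : G) nwalks (i + j) v v * nwalks (q.*2 - (i + j)) v v.
Proof.
move=> iq jq.
transitivity (\sum_(p : G * G) \sum_v
   (nwalks i p.1 v * nwalks (q - i) v p.2) * (nwalks j p.1 v * nwalks (q - j) v p.2)).
  apply: eq_bigr => p _.
  under [RHS]eq_bigr do rewrite -!sum_walks_through !subnKC // big_distrl.
  rewrite [RHS]exchange_big; apply: eq_bigr => P _ /=.
  under [RHS]eq_bigr do rewrite big_distrr.
  rewrite [RHS]exchange_big; apply: eq_bigr => Q _ /=.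
  rewrite (bigD1 (nth p.1 (p.1 :: Q) j)) //= eqxx muln1 big1 ?addn0 // => v.
  by rewrite eq_sym => /negbTE->; rewrite muln0.
rewrite exchange_big; apply: eq_bigr => v _ /=.
have -> : q.*2 - (i + j) = (q - i) + (q - j) by lia.
rewrite !nwalks_diagD big_distrl -(pair_bigA _ (fun x y =>
   (nwalks i x v * nwalks (q - i) v y) * (nwalks j x v * nwalks (q - j) v y))).
apply: eq_bigr => x _ /=; rewrite big_distrr; apply: eq_bigr => y _ /=.
by rewrite (nwalksC i) (nwalksC j) mulnACA.
Qed.

(* Asymmetric: only P has to be simple, as every walk P selected by
   [pairwise_avoiding] has some Q for which the pair is not degenerate. *)
Definition degenerate x P Q : bool :=
  ~~ uniq (x :: P) || has (mem (interior P)) (interior Q).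

Lemma degenerate_le q x P Q : size P = q -> size Q = q ->
  degenerate x P Q <=
    \sum_(ij : 'I_q.+1 * 'I_q.+1 | ij.1 < ij.2)
      (nth x (x :: P) ij.1 == nth x (x :: P) ij.2) +
    \sum_(ij : 'I_q.+1 * 'I_q.+1 | (0 < ij.1 < q) && (0 < ij.2 < q))
      (nth x (x :: P) ij.1 == nth x (x :: Q) ij.2).
Proof.
move=> Pq Qq; rewrite /degenerate; case: (boolP (uniq _)) => [_|]; last first.
  move=> /(uniqPn x)[i [j [ij]]]; rewrite /= Pq => jq nij.
  rewrite (bigD1 (Ordinal (ltn_trans ij jq), Ordinal jq)) //= nij eqxx.
  by rewrite -addnA.
case: hasP => // -[u] /(nthP x)[j + <-] /(nthP x)[i +].
rewrite /interior !size_take Pq Qq => ji ii.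
have {}ji : j < q.-1 by move: ji; case: ifP; lia.
have {}ii : i < q.-1 by move: ii; case: ifP; lia.
rewrite !nth_take // => nij.
(* Entry i of an interior is position i + 1 of the walk, strictly between 0 and q. *)
have iq : i.+1 < q.+1 by lia.
have jq : j.+1 < q.+1 by lia.
rewrite [X in _ + X](bigD1 (Ordinal iq, Ordinal jq)) /=; last by lia.
by rewrite nij eqxx; lia.
Qed.

Definition degenerate_pairs q x y :=
  \sum_(P <- walks_to q x y) \sum_(Q <- walks_to q x y) degenerate x P Q.

Lemma sum_degenerate_pairs q d : 0 < d -> (forall x : G, d <= degree x) ->
  \sum_(p : G * G) degenerate_pairs q p.1 p.2 <=
    2 * q.+1 ^ 2 * (max_degree G * closed_walks G q.*2.-2).
Proof.
move=> d0 le_d; set M := max_degree G * _.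
set I := ('I_q.+1 * 'I_q.+1)%type.
have sumI (C : pred I) (F : I -> nat) :
    (forall ij, C ij -> F ij <= M) -> \sum_(ij | C ij) F ij <= q.+1 ^ 2 * M.
  move=> FM; apply: (@leq_trans (\sum_(ij | C ij) M)); first exact: leq_sum.
  rewrite sum_nat_const leq_mul2r -mulnn; apply/orP; right.
  by apply: leq_trans (max_card _) _; rewrite card_prod card_ord.
have cut i : 0 < i < q.*2 -> \sum_(v : G) nwalks i v v * nwalks (q.*2 - i) v v <= M.
  exact: sum_nwalks_diag_ends le_d d0 _ _.
apply: (@leq_trans
 (\sum_(ij : I | ij.1 < ij.2) (\sum_(p : G * G)
   \sum_(P <- walks_to q p.1 p.2) \sum_(Q <- walks_to q p.1 p.2)
    (nth p.1 (p.1 :: P) ij.1 == nth p.1 (p.1 :: P) ij.2)) +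
  \sum_(ij : I | (0 < ij.1 < q) && (0 < ij.2 < q)) (\sum_(p : G * G)
   \sum_(P <- walks_to q p.1 p.2) \sum_(Q <- walks_to q p.1 p.2)
    (nth p.1 (p.1 :: P) ij.1 == nth p.1 (p.1 :: Q) ij.2)))); last first.
  rewrite -mulnA mul2n -addnn leq_add //; apply: sumI => -[i j] /= ij.
    have jq := ltn_ord j.
    by rewrite sum_walks_return_pairs ?cut; lia.
  by rewrite sum_walks_cross_pairs ?cut; lia.
rewrite exchange_big [X in _ + X]exchange_big -big_split; apply: leq_sum => p _ /=.
rewrite exchange_big [X in _ + X]exchange_big -big_split /degenerate_pairs !big_seq.
apply: leq_sum => P; rewrite mem_walks_to => /and3P[/eqP Pq _ _] /=.
rewrite exchange_big [X in _ + X]exchange_big -big_split !big_seq.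
apply: leq_sum => Q; rewrite mem_walks_to => /and3P[/eqP Qq _ _] /=.
exact: degenerate_le.
Qed.

End DegeneratePairs.

(** An entry of X in the first list hits no other list, so it can be deleted from X. *)
Lemma disjoint_hitting_size (T : eqType) (s : seq (seq T)) (X : seq T) :
  pairwise (fun P Q => ~~ has (mem P) Q) s -> all (has (mem X)) s -> size s <= size X.
Proof.
elim: s X => // P s IHs X /= /andP[/allP Ps ps] /andP[/hasP[v vP vX] /allP Xs].
apply: (@leq_ltn_trans (size [seq u <- X | u != v])).
  apply: IHs => //; apply/allP => Q Qs; have /hasP[u uQ uX] := Xs Q Qs.
  apply/hasP; exists u => //=; rewrite mem_filter andbC; apply/andP; split=> //.
  by apply: contra (Ps Q Qs) => /eqP uv; apply/hasP; exists u; rewrite // uv.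
rewrite size_filter -(count_predC (pred1 v) X) -addn1 addnC leq_add2r.
by rewrite -has_count has_pred1.
Qed.

(** * Heavy pairs and the choice of branch vertices *)

Section Heavy.
Variable G : sgraph.
Implicit Types (x y v : G) (t P Q : seq G).

(** Robust connection, as the greedy embedding requires. Only the interior avoids X, so X may
    contain the ends x and y. *)
Definition heavy q m x y : Prop := forall X : seq G, size X < m ->
  exists t, [/\ t \in walks_to q x y, uniq (x :: t) & ~~ has (mem X) (interior t)].

(** The negated hypothesis of [pairwise_avoiding] for unit weights and m selections. *)
Definition light q m x y : bool :=
  nwalks q x y ^ 2 <= 4 ^ m * degenerate_pairs q x y.

Lemma not_light_heavy q m x y : ~~ light q m x y -> heavy q m x y.
Proof.
rewrite -ltnNge => ltd X Xm.
have [|s [sz ps ms]] := @pairwise_avoiding _ (walks_to q x y) (fun=> 1) (degenerate x) m.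
  rewrite sum1_walks_to; congr (_ * _ < _): ltd; apply: eq_bigr => P _.
  by apply: eq_bigr => Q _; rewrite !mul1n.
have [t ts tX] : exists2 t, t \in s & ~~ has (mem X) (interior t).
  apply/hasP; rewrite (has_predC (fun t => has (mem X) (interior t))).
  apply: contraL Xm; rewrite -(all_map (@interior G) (has (mem X))).
  move=> /disjoint_hitting_size; rewrite size_map sz -leqNgt; apply.
  rewrite pairwise_map; apply: sub_pairwise ps => P Q /=.
  by rewrite /degenerate negb_or => /andP[].
have [tl _ [Q _ [_]]] := ms t ts.
by rewrite /degenerate negb_or negbK => /andP[ut _]; exists t.
Qed.

(** Makes the branch vertices distinct, which [pairwise_avoiding] does not assert. *)
Lemma heavy_neq q m x y : 0 < q -> 0 < m -> heavy q m x y -> x != y.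
Proof.
move=> q0 m0 /(_ [::] m0)[[|u t]]; rewrite mem_walks_to.
  by case=> /andP[/eqP q0']; rewrite -q0' in q0.
case=> /and3P[_ _ /eqP<-] /= /andP[xt _] _.
by apply: contra xt => /eqP->; exact: mem_last.
Qed.

(** The factor 2 pays for symmetrising [light], [4 ^ m] for its threshold, [4 ^ r] for the
    selection. *)
Lemma ex_pairwise_heavy k r m :
  4 ^ r * (2 * (4 ^ m * \sum_(p : G * G) degenerate_pairs k.*2 p.1 p.2)) <
    closed_walks G k.*2.*2 ->
  exists2 s : seq G, size s = r &
    pairwise (fun x y => ~~ (light k.*2 m x y || light k.*2 m y x)) s.
Proof.
set q := k.*2 => few; pose L := light q m; pose B x y := L x y || L y x.
pose w (p : G * G) x := nwalks k p.1 x * nwalks k p.2 x.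
have wE p : \sum_x w p x = nwalks q p.1 p.2.
  by rewrite /q -addnn nwalksD; apply: eq_bigr => x _; rewrite /w (nwalksC k p.2).
(* The sum over p = (z, z') factors; each factor counts walks from x to y by their midpoint z or
   z'. *)
have wwE x y : \sum_p w p x * w p y = nwalks q x y ^ 2.
  rewrite -mulnn {1 2}/q -addnn !nwalksD big_distrl /=.
  rewrite -(pair_bigA _ (fun z z' => w (z, z') x * w (z, z') y)).
  apply: eq_bigr => z _; rewrite big_distrr; apply: eq_bigr => z' _ /=.
  by rewrite /w /= (nwalksC k z x) (nwalksC k z' x) mulnACA.
pose S (C : rel G) := \sum_x \sum_y nwalks q x y ^ 2 * C x y.
have SL : S L <= 4 ^ m * \sum_(p : G * G) degenerate_pairs q p.1 p.2.
  rewrite /S pair_bigA big_distrr; apply: leq_sum => p _ /=.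
  by rewrite /L; case: (boolP (light _ _ _ _)) => h; rewrite ?muln0 // muln1.
have SB : S B <= 2 * S L.
  rewrite mul2n -addnn {2}/S exchange_big -big_split; apply: leq_sum => x _.
  rewrite -big_split; apply: leq_sum => y _ /=.
  rewrite (nwalksC q y x) -mulnDr leq_mul2l /B.
  by case: (L x y); case: (L y x); rewrite ?orbT.
have [p _ lt_p] : exists2 p, p \in index_enum (G * G)%type &
    4 ^ r * (\sum_x \sum_y w p x * w p y * B x y) < (\sum_x w p x) ^ 2.
  apply: ltn_sum_ex; rewrite -big_distrr /=.
  have -> : \sum_p (\sum_x w p x) ^ 2 = closed_walks G q.*2.
    rewrite -addnn closed_walksD pair_bigA; apply: eq_bigr => p _.
    by rewrite wE mulnn.
  apply: leq_ltn_trans few; rewrite leq_mul2l; apply/orP; right.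
  apply: leq_trans (leq_trans SB _); last by rewrite leq_mul2l SL orbT.
  rewrite exchange_big leq_sum // => x _; rewrite exchange_big leq_sum // => y _.
  by rewrite -big_distrl -wwE.
have [s [sz ps _]] := pairwise_avoiding lt_p.
by exists s.
Qed.

End Heavy.

(** * Greedy embedding of the subdivision *)

Section Embedding.
Variables (G : sgraph) (F : multigraph) (q m : nat) (phi : mvertex F -> G).
Hypothesis q_gt0 : 0 < q.
Hypothesis phi_inj : injective phi.
Hypothesis phi_heavy : forall e, heavy q m (phi (src e)) (phi (tgt e)).

(** Edges are routed one by one; branch vertices and the interiors of earlier walks number fewer
    than m, so heaviness avoids them. *)
Lemma ex_disjoint_walks (es : seq (medge F)) :
  uniq es -> #|mvertex F| + size es * q < m ->
  exists g : medge F -> seq G,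
    {in es, forall e, [/\ g e \in walks_to q (phi (src e)) (phi (tgt e)),
      uniq (phi (src e) :: g e) & ~~ has (mem (codom phi)) (interior (g e))]} /\
    {in es &, forall e e', e != e' -> ~~ has (mem (interior (g e))) (interior (g e'))}.
Proof.
elim: es => [|e es IHes] /=; first by exists (fun=> [::]).
rewrite mulSn => /andP[e_es ues] szm.
have {IHes}[|g [gP gD]] := IHes ues.
  by apply: leq_ltn_trans szm; rewrite leq_add2l leq_addl.
pose X := codom phi ++ flatten [seq interior (g e') | e' <- es].
have [|t [tw ut tX]] := phi_heavy e (X := X).
  apply: leq_ltn_trans szm; rewrite size_cat size_codom leq_add2l.
  rewrite size_flatten /shape -map_comp sumnE big_map.
  apply: (@leq_trans (\sum_(e' <- es) q)).
    rewrite !big_seq; apply: leq_sum => e' /gP[+ _ _].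
    rewrite mem_walks_to => /and3P[/eqP<- _ _] /=.
    by rewrite size_take; case: ifP; lia.
  by rewrite big_const_seq count_predT iter_addn_0 mulnC leq_addl.
have avoid u : u \in interior t -> (u \notin codom phi) /\
    {in es, forall e', u \notin interior (g e')}.
  move=> ut'; have /hasPn/(_ u ut') := tX.
  rewrite /= mem_cat negb_or => /andP[? uX]; split => // e' e'es.
  by apply: contra uX => ue'; apply/flatten_mapP; exists e'.
exists (fun e' => if e' == e then t else g e'); split => [e'|e1 e2].
  rewrite inE; case: eqVneq => [-> _|_ /= /gP //]; split => //.
  by apply/hasPn => u /avoid[].
rewrite !inE; case: (eqVneq e1 e) => [->|_] /=; case: (eqVneq e2 e) => [->|_] //=.
- move=> _ e2es _; apply/hasPn => u ue2; apply/negP => /avoid[_ /(_ _ e2es)].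
  by rewrite ue2.
- by move=> e1es _ _; apply/hasPn => u /avoid[_ /(_ _ e1es)].
- exact: gD.
Qed.

Lemma heavy_contains_copy :
  #|mvertex F| + #|medge F| * q < m -> contains_copy G (subdivision F (q - 1)).
Proof.
move=> szm.
have [|g [gP gD]] := ex_disjoint_walks (enum_uniq (medge F)); first by rewrite -cardE.
have {}gP e := gP e (mem_enum _ _).
have {}gD e e' := gD e e' (mem_enum _ _) (mem_enum _ _).
have sz e : size (g e) = q.
  by have [+ _ _] := gP e; rewrite mem_walks_to => /and3P[/eqP].
have szi e : size (interior (g e)) = q - 1.
  by rewrite size_take sz subn1 prednK // leqnn.
pose f (u : subdivision F (q - 1)) : G :=
  match u with inl a => phi a | inr (e, o) => nth (phi (src e)) (interior (g e)) o end.
have f_int e (o : 'I_(q - 1)) : f (inr (e, o)) \in interior (g e).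
  by rewrite mem_nth // szi.
have int_phi e a : phi a \notin interior (g e).
  have [_ _ /hasPn av] := gP e; apply/negP => /av /=; rewrite codom_f //.
(* At i = q the index q - 1 is outside ['I_(q - 1)], so [subdiv_path] gives [tgt e], matching the
   last entry of the walk. *)
have f_path e i : i <= q ->
    f (subdiv_path (q - 1) e i) = nth (phi (src e)) (phi (src e) :: g e) i.
  case: i => // i iq /=; case: insubP => [j _ <-|ji] /=.
    by rewrite nth_take // sz -subn1.
  have [+ _ _] := gP e; rewrite mem_walks_to => /and3P[_ _ /eqP<-].
  by rewrite -nth_last sz; congr nth; lia.
exists f => [[a|[e o]] [b|[e' o']]|x y] /=.
- by move/phi_inj->.
- by move=> ab; have := int_phi e' a; rewrite ab f_int.
- by move=> ab; have := int_phi e b; rewrite -ab f_int.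
- have [<-|ee'] := eqVneq e e'.
    have [_ /= /andP[_ ug] _] := gP e.
    move=> /eqP; rewrite nth_uniq ?szi ?take_uniq // => /eqP oo'.
    by congr (inr (_, _)); exact: val_inj.
  move=> ff'; have /hasPn/(_ _ (f_int e' o')) := gD _ _ ee'.
  by rewrite /= -ff' f_int.
case/existsP=> e /existsP[i]; have iq := ltn_ord i; case/orP=> /andP[/eqP-> /eqP->].
  rewrite !f_path; try lia.
  have [+ _ _] := gP e; rewrite mem_walks_to => /and3P[_ /(pathP (phi (src e))) + _].
  by apply; rewrite sz; lia.
rewrite adj_sym !f_path; try lia.
have [+ _ _] := gP e; rewrite mem_walks_to => /and3P[_ /(pathP (phi (src e))) + _].
by apply; rewrite sz; lia.
Qed.

End Embedding.

(** * An explicit density condition *)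

Definition copy_size (F : multigraph) k := #|mvertex F| + #|medge F| * k.*2.

(* Collects the losses of [ex_pairwise_heavy] and [sum_degenerate_pairs] when the
   maximum degree is at most K times the minimum degree. *)
Definition density_threshold (F : multigraph) k K :=
  4 ^ #|mvertex F| * (2 * (4 ^ (copy_size F k).+1 * (2 * k.*2.+1 ^ 2 * K))).

(** With T the threshold and n = [#|G|], too many degenerate pairs would give d^(4k) <= (T d)^(2k) n
    by [closed_walks_drop]; cancelling d^(2k) contradicts the density hypothesis. *)
Lemma dense_contains_copy (F : multigraph) k K (G : sgraph) d :
  0 < k -> 0 < #|G| -> 0 < d -> (forall v : G, d <= degree v) ->
  max_degree G <= K * d -> density_threshold F k K ^ k.*2 * #|G| < d ^ k.*2 ->
  contains_copy G (subdivision F (k.*2 - 1)).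
Proof.
move=> k0 G0 d0 le_d Dd dense; set q := k.*2 in dense *; set m := (copy_size F k).+1.
have q0 : 0 < q by rewrite double_gt0.
have [x0 _] : exists x0, x0 \in G by apply/card_gt0P.
have [|s sz ps] := @ex_pairwise_heavy G k #|mvertex F| m.
  apply: (@leq_ltn_trans (density_threshold F k K * d * closed_walks G q.*2.-2)).
    rewrite /density_threshold -!mulnA; do 3 ! apply: leq_mul => //.
    apply: leq_trans (sum_degenerate_pairs q d0 le_d) _.
    by rewrite -!mulnA (mulnA K); do 4 ! apply: leq_mul => //.
  rewrite ltnNge; apply/negP => /(closed_walks_drop le_d d0 G0 q0).
  rewrite leqNgt -addnn expnD expnMn mulnAC ltn_mul2r expn_gt0 d0 /=.
  by rewrite dense.
pose phi (a : mvertex F) := nth x0 s (enum_rank a).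
have phi_heavy a b : a != b -> heavy q m (phi a) (phi b).
  have lt_s (a' : mvertex F) : (enum_rank a' : nat) \in gtn (size s) by rewrite inE sz.
  have {}ps := pairwiseP x0 ps.
  (* The ranks of a and b come in either order, hence the exclusion of [light] in both
     directions. *)
  rewrite -(inj_eq enum_rank_inj) -(inj_eq val_inj) neq_ltn /= => /orP[] ab;
    apply: not_light_heavy; [have := ps _ _ (lt_s a) (lt_s b) ab
                            |have := ps _ _ (lt_s b) (lt_s a) ab];
    by rewrite negb_or => /andP[].
apply: (@heavy_contains_copy G F q m phi) => // [a b ab|e].
  apply/eqP; apply: contraT => /phi_heavy /(heavy_neq q0 (ltn0Sn _)).
  by rewrite ab eqxx.
exact/phi_heavy/no_loop.
Qed.

(** * The asymptotic statement *)

Lemma min_degree_le (G : sgraph) (v : G) : (min_degree G <= degree v)%N.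
Proof.
rewrite /min_degree; elim: (index_enum G) (mem_index_enum v) => // u s IHs.
rewrite big_cons inE geq_min => /orP[/eqP<-|/IHs->]; last by rewrite orbT.
by rewrite leqnn.
Qed.

Local Open Scope classical_set_scope.
Local Open Scope ring_scope.

Theorem theorem2p2 (R : realType) (F : multigraph) (k : nat) (K : R)
    (delta : nat -> nat) :
  (1 <= k)%N ->
  1 <= K ->
  (delta n)%:R / (n%:R `^ ((2 * k)%:R^-1) : R) @[n --> \oo] --> +oo ->
  \forall n \near \oo, forall G : sgraph,
    #|G| = n ->
    almost_regular K G ->
    min_degree G = delta n ->
    contains_copy G (subdivision F (2 * k - 1)).
Proof.
move=> k1 K1 /cvgryPgt delta_oo.
(* [Num.bound K] is a natural number above K, so the counting bounds apply. *)
set c := density_threshold F k (Num.bound K).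
near=> n => G Gn regG minG.
have n0 : (0 < n)%N by near: n; exact: nbhs_infty_gt.
have c_lt : c%:R < (delta n)%:R / (n%:R `^ ((2 * k)%:R^-1)) :> R.
  by near: n; exact: delta_oo.
have root_gt0 : 0 < n%:R `^ ((2 * k)%:R^-1) :> R by rewrite powR_gt0 // ltr0n.
rewrite ltr_pdivlMr // in c_lt.
have k2_neq0 : (2 * k)%N != 0%N by rewrite muln_eq0 -lt0n.
have delta_gt0 : (0 < delta n)%N.
  by rewrite -(ltr0n R); apply: le_lt_trans c_lt; rewrite mulr_ge0 ?ler0n // ltW.
have dense : (c ^ (2 * k) * n < delta n ^ (2 * k))%N.
  rewrite -(ltr_nat R) natrM !natrX.
  have -> : n%:R = (n%:R `^ ((2 * k)%:R^-1)) ^+ (2 * k) :> R.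
    by rewrite -powR_mulrn ?powR_ge0 // -powRrM mulVf ?pnatr_eq0 // powRr1.
  by rewrite -exprMn ltr_pXn2r // ?lt0n // nnegrE ?ler0n // mulr_ge0 // ?ler0n // ltW.
rewrite mul2n; apply: (@dense_contains_copy F k (Num.bound K) G (delta n)).
- by [].
- by rewrite Gn.
- by [].
- by move=> v; rewrite -minG min_degree_le.
- rewrite -(ler_nat R) natrM -minG; apply: le_trans regG _.
  by rewrite ler_wpM2r // ltW // archi_boundP // (le_trans ler01).
- by rewrite Gn -mul2n.
Unshelve. all: by end_near.
Qed.
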